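(* If $(\mathbb V,\operatorname{dist})$ is a complete and perfect metric space, then the set of subshifts of finite type on Cantor spaces, that is, the set of those $f\in\mathcal{DS}(\mathbb V)$ such that $M(f)$ is a Cantor space and $f$ is a homeomorphism of $M(f)$ topologically conjugate to a subshift of finite type, is dense in $(\mathcal{DS}(\mathbb V),\mathrm{D_H})$.
   Context: A topological space is perfect if it has no isolated points. A Cantor space is a (nonempty) compact, perfect, totally disconnected metric space. For a metric space $(N,\operatorname{dist})$, $\mathcal K(N)$ is the set of nonempty compact subsets of $N$ with the Hausdorff distance. On $\mathbb V^2=\mathbb V\times\mathbb V$ use the max-metric $\operatorname{dist}_2((a,b),(c,d))=\max\{\operatorname{dist}(a,c),\operatorname{dist}(b,d)\}$, and let $\pi_1,\pi_2:\mathbb V^2\to\mathbb V$ be the coordinate projections. Define $\mathcal{DS}(\mathbb V)=\{f\in\mathcal K(\mathbb V^2):\pi_1(f)=\pi_2(f)\}$, with metric $\mathrm{D_H}$ the Hausdorff distance associated to $\operatorname{dist}_2$. For $f\in\mathcal{DS}(\mathbb V)$ put $M(f)=\pi_1(f)=\pi_2(f)$. Functions are identified with their graphs, so a homeomorphism of a nonempty compact set $M\subset\mathbb V$ onto itself is an element of $\mathcal{DS}(\mathbb V)$. A subshift of finite type is the (two-sided) shift map restricted to a closed shift-invariant subset of $Q^{\mathbb Z}$ ($Q$ a finite alphabet with the discrete topology, $Q^{\mathbb Z}$ with the product topology) defined by a finite list of forbidden words. Homeomorphisms $f:X\to X$ and $g:Y\to Y$ are topologically conjugate if there is a homeomorphism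 $\varphi:X\to Y$ with $g\varphi=\varphi f$. *)

(* Defs.v *)
From HB Require Import structures.
From mathcomp Require Import all_boot all_order all_algebra.
From mathcomp Require Import all_classical all_reals.
From mathcomp Require Import topology normedtype.

Set Implicit Arguments.
Unset Strict Implicit.
Unset Printing Implicit Defensive.

Import Order.TTheory GRing.Theory Num.Theory.
Import numFieldTopology.Exports numFieldNormedType.Exports.

Local Open Scope classical_set_scope.
Local Open Scope ring_scope.

(* The library's [completeType] is pointed, which would exclude the empty
   metric space; hence the explicit property. *)
Definition complete_space (T : uniformType) : Prop :=
  forall u : nat -> T, cauchy (u @ \oo) -> exists l : T, u @ \oo --> l.

Definition perfect (T : topologicalType) (A : set T) : Prop :=
  isolated A = set0.

Definition is_cantor_space (R : realType) (V : metricType R) (A : set V) :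
    Prop :=
  [/\ A !=set0, compact A, perfect A & totally_disconnected A].

Definition homeomorphism (X Y : topologicalType) (f : X -> Y) : Prop :=
  exists g : Y -> X, [/\ continuous f, continuous g, cancel f g & cancel g f].

Definition topologically_conjugate (X Y : topologicalType)
    (f : X -> X) (g : Y -> Y) : Prop :=
  exists phi : X -> Y, homeomorphism phi /\ g \o phi = phi \o f.

(* The max-metric on a product; it induces the library's product topology. *)
Section prod_metric.
Context {R : realType} {U V : metricType R}.

Definition max_dist (x y : U * V) : R :=
  Num.max (mdist x.1 y.1) (mdist x.2 y.2).

Let max_dist_ge0 x y : 0 <= max_dist x y.
Proof. by rewrite /max_dist le_max mdist_ge0. Qed.

Let max_dist_positivity x y : max_dist x y = 0 -> x = y.
Proof.
case: x y => [a b] [c d] /= xy.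
have: max_dist (a, b) (c, d) <= 0 by rewrite xy.
rewrite /max_dist ge_max /= => /andP[ac bd].
by congr pair; apply: mdist_positivity; apply/eqP; rewrite eq_le mdist_ge0 andbT.
Qed.

Let ball_max_dist (x : U * V) d : ball x d = [set y | max_dist x y < d].
Proof.
apply/seteqP; split=> y; rewrite /max_dist /= gt_max.
  by rewrite /ball/= /prod_ball !ballEmdist/= => -[-> ->].
by move=> /andP[? ?]; rewrite /ball/= /prod_ball !ballEmdist.
Qed.

HB.instance Definition _ := PseudoMetric_isMetric.Build R (U * V)%type
  max_dist_ge0 max_dist_positivity ball_max_dist.

End prod_metric.

Record compacts (R : realType) (N : metricType R) := Compacts {
  compacts_set :> set N ;
  compacts_neq0 : compacts_set !=set0 ;
  compacts_compact : compact compacts_set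
}.

Section hausdorff_metric.
Context {R : realType} {N : metricType R}.
Implicit Types A B C : compacts N.

Definition point_set_dist (a : N) (B : set N) : R :=
  inf [set mdist a b | b in B].

Definition excess (A B : set N) : R :=
  sup [set point_set_dist a B | a in A].

Definition hausdorff_dist (A B : set N) : R :=
  Num.max (excess A B) (excess B A).

Lemma compacts_inj A B : compacts_set A = compacts_set B -> A = B.
Proof.
case: A B => [A A0 cA] [B B0 cB] /= AB; rewrite AB in A0 cA *.
by rewrite (Prop_irrelevance A0 B0) (Prop_irrelevance cA cB).
Qed.

Lemma mdist_has_lbound a (B : set N) : has_lbound [set mdist a b | b in B].
Proof. by exists 0 => _ [b _ <-]; exact: mdist_ge0. Qed.

Lemma point_set_dist_ge0 a B : 0 <= point_set_dist a B.
Proof.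
have [b Bb] := compacts_neq0 B; apply: lb_le_inf; first by exists (mdist a b), b.
by move=> _ [c _ <-]; exact: mdist_ge0.
Qed.

Lemma point_set_dist_le a b (B : set N) : B b -> point_set_dist a B <= mdist a b.
Proof. by move=> Bb; apply: ge_inf; [exact: mdist_has_lbound|exists b]. Qed.

Lemma mdist_continuous (b : N) : continuous (fun x => mdist b x : R).
Proof.
move=> x; apply/cvgrPdist_lt => /= e e0.
near=> y.
have xy : mdist x y < e.
  near: y; have := nbhsx_ballx x e e0.
  by rewrite ballEmdist.
have := metric_triangle b x y; have := metric_triangle b y x.
rewrite (metric_sym y x) -!lerBlDl => h1 h2.
by rewrite (le_lt_trans _ xy)// ler_norml lerNl opprB h1 h2.
Unshelve. all: by end_near. Qed.

Lemma compacts_bounded A (b : N) : exists M : R, forall a, (A : set N) a -> mdist b a <= M.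
Proof.
have cf : {within A, continuous (fun x => mdist b x : R)}.
  by apply: continuous_subspaceT; exact: mdist_continuous.
have /compact_bounded[M [_ HM]] :=
  continuous_compact cf (@compacts_compact _ _ A).
exists (M + 1) => a Aa; rewrite (le_trans (ler_norm _))//.
by apply: (HM (M + 1)); [rewrite ltrDl|exists a].
Qed.

Lemma excess_has_ubound A B : has_ubound [set point_set_dist a B | a in A].
Proof.
have [b Bb] := compacts_neq0 B; have [M HM] := compacts_bounded A b.
exists M => _ [a Aa <-]; rewrite (le_trans (point_set_dist_le a Bb))//.
by rewrite metric_sym HM.
Qed.

Lemma point_set_dist_le_excess A B a :
  (A : set N) a -> point_set_dist a B <= excess A B.
Proof. by move=> Aa; apply: ub_le_sup; [exact: excess_has_ubound|exists a]. Qed.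

Lemma excess_le A (B : set N) (r : R) :
  (forall a, (A : set N) a -> point_set_dist a B <= r) -> excess A B <= r.
Proof.
have [a Aa] := compacts_neq0 A => AB; apply: ge_sup.
  by exists (point_set_dist a B), a.
by move=> _ [c Ac <-]; exact: AB.
Qed.

Lemma excess_ge0 A B : 0 <= excess A B.
Proof.
have [a Aa] := compacts_neq0 A.
exact: le_trans (point_set_dist_ge0 a B) (point_set_dist_le_excess B Aa).
Qed.

Lemma excess_xx A : excess A A = 0.
Proof.
apply/eqP; rewrite eq_le excess_ge0 andbT; apply: excess_le => a Aa.
by rewrite (le_trans (point_set_dist_le a Aa))// mdistxx.
Qed.

Lemma excess_le0_subset A B : excess A B <= 0 -> A `<=` B.
Proof.
move=> AB a Aa.
have cB : closure B `<=` B.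
  apply: compact_closed; [exact: metric_hausdorff|exact: compacts_compact].
apply: cB => U /nbhs_ballP[e /= e0 eU].
have [_ [b Bb <-] abe] : exists2 y, [set mdist a b | b in B] y & y < e.
  apply: inf_lt.
    by have [b Bb] := compacts_neq0 B; exists (mdist a b), b.
  exact: le_lt_trans (le_trans (point_set_dist_le_excess B Aa) AB) e0.
by exists b; split => //; apply: eU; rewrite ballEmdist.
Qed.

Lemma excess_triangle B A C : excess A C <= excess A B + excess B C.
Proof.
apply: excess_le => a Aa; rewrite -lerBlDr.
apply: le_trans (point_set_dist_le_excess B Aa).
apply: lb_le_inf; first by have [b Bb] := compacts_neq0 B; exists (mdist a b), b.
move=> _ [b Bb <-]; rewrite lerBlDr -lerBlDl.
apply: le_trans (point_set_dist_le_excess C Bb).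
apply: lb_le_inf; first by have [c Cc] := compacts_neq0 C; exists (mdist b c), c.
move=> _ [c Cc <-]; rewrite lerBlDl.
exact: le_trans (point_set_dist_le a Cc) (metric_triangle _ _ _).
Qed.

Let dist A B := hausdorff_dist A B.

Let distxx A : dist A A = 0.
Proof. by rewrite /dist /hausdorff_dist excess_xx maxxx. Qed.

Let dist_positivity A B : dist A B = 0 -> A = B.
Proof.
move=> AB; have: dist A B <= 0 by rewrite AB.
rewrite /dist /hausdorff_dist ge_max => /andP[? ?].
by apply: compacts_inj; apply/seteqP; split; exact: excess_le0_subset.
Qed.

Let dist_sym A B : dist A B = dist B A.
Proof. by rewrite /dist /hausdorff_dist maxC. Qed.

Let dist_triangle B A C : dist A C <= dist A B + dist B C.
Proof.
rewrite /dist /hausdorff_dist ge_max; apply/andP; split.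
  by rewrite (le_trans (excess_triangle B A C))// lerD// le_max lexx.
rewrite (le_trans (excess_triangle B C A))// addrC lerD// le_max lexx ?orbT//.
Qed.

HB.instance Definition _ := gen_eqMixin (compacts N).
HB.instance Definition _ := gen_choiceMixin (compacts N).
HB.instance Definition _ := isMetric.Build R (compacts N)
  distxx dist_positivity dist_sym dist_triangle.

End hausdorff_metric.

(* As a type, [DS V] is a subspace of [compacts (V * V)]: its topology is the
   one defined by the Hausdorff distance of the max-metric. *)
Definition DS (R : realType) (V : metricType R) : set (compacts (V * V)%type) :=
  [set f | fst @` f = snd @` f].
Arguments DS {R} V.

Definition relation_of (R : realType) (V : metricType R) (f : DS V) :
  set (V * V) := compacts_set (\val f).

Definition M (R : realType) (V : metricType R) (f : DS V) : set V :=
  fst @` relation_of f.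

Lemma DS_denseP (R : realType) (V : metricType R) (S : set (DS V)) :
  dense S <-> forall (f : DS V) (e : R), 0 < e ->
    exists2 g, S g & hausdorff_dist (relation_of f) (relation_of g) < e.
Proof.
split=> [dS f e e0|dS O [f Of] [O' oO' OO']].
  pose B : set (compacts (V * V)%type) := ball (\val f) e.
  have fB : nbhs (\val f) B by exact: nbhsx_ballx.
  have [||g [Bg Sg]] := dS ((fun g : DS V => \val g) @^-1` B^°).
  - by exists f; exact: fB.
  - by exists B^° => //; exact: open_interior.
  exists g => //; have := interior_subset Bg.
  by rewrite /B ballEmdist.
have [e /= e0 eO] : nbhs_ball (\val f) O'.
  apply/nbhs_ballP/open_nbhs_nbhs; split => //.
  by have : O f := Of; rewrite -OO'.
have [g Sg fg] := dS f e e0; exists g; split => //.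
rewrite -OO'; apply: eO; rewrite ballEmdist; exact: fg.
Qed.

Section subshift.
Context (Q : finType).

Definition full_shift := prod_topology (fun _ : int => discrete_topology Q).

HB.instance Definition _ := Topological.on full_shift.

Definition shift_map (x : full_shift) : full_shift := fun i => x (i + 1).

Definition occurs (w : seq Q) (x : full_shift) : Prop :=
  exists i : int, [seq x (i + k%:Z) | k <- iota 0 (size w)] = w.

Definition sft (F : seq (seq Q)) : set full_shift :=
  [set x | forall w, w \in F -> ~ occurs w x].

Lemma sft_shift_subproof F (x : sft F) : shift_map (\val x) \in sft F.
Proof.
case: x => x /= /set_mem Fx; apply/mem_set => w wF [i xw].
apply: (Fx w wF); exists (i + 1); rewrite -[RHS]xw.
by apply: eq_map => k /=; rewrite /shift_map addrAC.
Qed.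

Definition sft_shift F (x : sft F) : sft F :=
  exist _ (shift_map (\val x)) (sft_shift_subproof x).

End subshift.

Definition is_graph_of (R : realType) (V : metricType R) (A : set V)
    (f : set (V * V)) (h : A -> A) : Prop :=
  f = range (fun x : A => (\val x, \val (h x))).

Definition sft_homeomorphism (R : realType) (V : metricType R) (f : DS V) :
    Prop :=
  exists h : M f -> M f,
    [/\ is_graph_of (relation_of f) h,
        homeomorphism h &
        exists (Q : finType) (F : seq (seq Q)),
          topologically_conjugate h (@sft_shift Q F)].

(* Main.v *)
Require Import Defs.
From mathcomp Require Import all_boot all_order all_algebra.
From mathcomp Require Import all_classical all_reals.
From mathcomp Require Import topology normedtype.
From mathcomp Require Import lra.

(** Given [f] and a scale [d], choose a finite [d]-net [p_0, ..., p_n] of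
  [M f] and a labelling [r] of the points of [M f] by nearby net points.  The
  pairs [(r a, r b)] with [(a, b)] in [f] are the edges of a finite digraph
  [G].  Its bi-infinite walks form a subshift of finite type, the forbidden
  words being the non-edges.  Since [f] has equal projections, every pair of
  [f] extends in both directions to a bi-infinite [f]-orbit, whose labels form
  a walk; hence every edge of [G] is used by a walk at time 0.  This shift may
  have isolated points (for example when [G] is a single cycle), so each
  vertex is doubled by a free bit: the resulting shift [X] is still of finite
  type, projects onto the same edges, and is perfect because a bit can be
  flipped arbitrarily far from the origin
  ([sft_forbidden_edges_perfect]).

  It remains to place [X] in [V].  As [V] is perfect, any finite family of
  points can be perturbed to a family of distinct points; iterating this
  inside balls of shrinking radii gives a Cantor scheme, and completeness
  turns its branches into points ([cantor_scheme_embedding]).  The outcome is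
  an embedding [phi] of the whole full shift sending [x] close to the net point
  named by [x 0] ([metric_coding_exists]).  The image [phi @` X] is a Cantor
  space, on which the shift is transported to a homeomorphism with graph
  [{(phi x, phi (shift x)) | x in X}].  Such a pair lies near the pair of net
  points named by the edge [(x 0, x 1)] of [G], and these edges are exactly
  the labels of the pairs of [f]; so the graph is Hausdorff-close to [f]. *)

Set Implicit Arguments.
Unset Strict Implicit.
Unset Printing Implicit Defensive.

Import Order.TTheory GRing.Theory Num.Theory.

Local Open Scope classical_set_scope.
Local Open Scope ring_scope.

(** * Cantor schemes in complete perfect metric spaces *)

Section perfect_spreading.
Context {R : realType} {V : metricType R} (V_perfect : perfect [set: V]).

(** Besides the finite set [s], the centre [x] itself is avoided: this makes the
  induction on [s] go through, since the radius can then be shrunk to exclude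
  one more point. *)
Lemma perfect_ball_avoid (x : V) (s : seq V) (r : R) : 0 < r ->
  exists y, [/\ y != x, y \notin s & mdist x y < r].
Proof.
elim: s r => [|a s IH] r r0.
  apply: contrapT => noy.
  suff : isolated [set: V] x by rewrite V_perfect.
  split; first exact/mem_set.
  exists (ball x r); first exact: nbhsx_ballx.
  rewrite setIT; apply/seteqP; split=> y; last by move=> ->; exact: ballxx.
  rewrite ballEmdist /= => xy; apply: contrapT => /eqP yx.
  by apply: noy; exists y.
have [->|xa] := eqVneq a x.
  have [y [yx ys xy]] := IH r r0.
  by exists y; rewrite in_cons negb_or yx ys.
have := IH (Num.min r (mdist x a)).
rewrite lt_min r0 mdist_gt0 eq_sym xa => /(_ isT)[y [yx ys]].
rewrite lt_min => /andP[xyr xya]; exists y; split => //.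
rewrite in_cons negb_or ys andbT; apply/eqP => ya.
by move: xya; rewrite ya ltxx.
Qed.

Lemma perfect_inj_perturbation (Q : finType) (p : Q -> V) (r : R) : 0 < r ->
  exists2 c : Q -> V, injective c & forall q, mdist (p q) (c q) < r.
Proof.
move=> r0.
suff [c ci cp] : exists2 c : Q -> V, {in enum Q &, injective c} &
    forall q, q \in enum Q -> mdist (p q) (c q) < r.
  by exists c => [q q' | q]; [apply: ci | apply: cp]; rewrite mem_enum.
elim: (enum Q) => [|a s [c ci cp]]; first by exists p.
have [y [_ ys ay]] := perfect_ball_avoid (p a) [seq c q | q <- s] r0.
exists (fun q => if q == a then y else c q) => [q q'|q]; rewrite !in_cons.
  have [->|qa] := eqVneq q a; have [->|qa'] := eqVneq q' a => //=.
  - by move=> _ q's yc; move: ys; rewrite yc map_f.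
  - by move=> qs _ yc; move: ys; rewrite -yc map_f.
  - exact: ci.
by have [->|qa] := eqVneq q a => //=; exact: cp.
Qed.

(** The factor 3 leaves room for points at distance at most [c.2] from two
  distinct [c.1 q], [c.1 q'] to be still [c.2]-apart. *)
Lemma perfect_separated_perturbation (Q : finType) (p : Q -> V) (r : R) :
  0 < r -> exists c : (Q -> V) * R,
    [/\ 0 < c.2, c.2 <= r, forall q, mdist (p q) (c.1 q) < r &
        forall q q', q != q' -> 3 * c.2 <= mdist (c.1 q) (c.1 q')].
Proof.
move=> r0; have [c ci cp] := perfect_inj_perturbation p r0.
pose rho := \big[Num.min/r]_(qq : Q * Q | qq.1 != qq.2)
  (mdist (c qq.1) (c qq.2) / 3).
exists (c, rho); split => //=.
- apply: lt_bigmin => // -[q q'] /= qq'.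
  by rewrite divr_gt0// mdist_gt0; apply: contra_neq qq'; exact: ci.
- exact: bigmin_le_id.
- move=> q q' qq'; rewrite mulrC -ler_pdivlMr//.
  exact: (@bigmin_le_cond _ _ _ _ (q, q')).
Qed.

End perfect_spreading.

Lemma half_pow_small {R : realType} (r e : R) : 0 < e ->
  exists N, r / 2 ^+ N < e.
Proof.
move=> e0; exists (Num.bound `|r / e|).
rewrite ltr_pdivrMr ?exprn_gt0// mulrC -ltr_pdivrMr//.
rewrite (le_lt_trans (ler_norm _))// (lt_trans (archi_boundP _))//.
by rewrite -natrX ltr_nat ltn_expl.
Qed.

(** A sequence [y] is sent to the limit of the centres of nested balls, where
  the [n]-th ball is selected by [y n] among separated balls indexed by [Q].
  The balls of level [n] inside a given one are mutually apart, so [phi y]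
  determines [y], with a modulus that may depend on [y]; their radii are at
  most [r / 2 ^ n], so a prefix of [y] determines [phi y] uniformly well. *)
Lemma cantor_scheme_embedding {R : realType} {V : metricType R}
    (V_complete : complete_space V) (V_perfect : perfect [set: V])
    (Q : finType) (p : Q -> V) (r : R) : 0 < r ->
  exists phi : (nat -> Q) -> V, [/\
    forall y, mdist (p (y 0%N)) (phi y) < 2 * r,
    forall e, 0 < e -> exists N, forall y y',
      (forall n, (n < N)%N -> y n = y' n) -> mdist (phi y) (phi y') < e &
    forall y N, exists2 e, 0 < e & forall y', mdist (phi y) (phi y') < e ->
      forall n, (n < N)%N -> y n = y' n].
Proof.
move=> r0.
have /choice[C CP] : forall pr : (Q -> V) * R, exists c : (Q -> V) * R,
    0 < pr.2 -> [/\ 0 < c.2, c.2 <= pr.2,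
      forall q, mdist (pr.1 q) (c.1 q) < pr.2 &
      forall q q', q != q' -> 3 * c.2 <= mdist (c.1 q) (c.1 q')].
  move=> [p' r']; have [r'0|r'0] := ltP 0 r'; last by exists (p', r').
  by have [c Hc] := perfect_separated_perturbation V_perfect p' r'0; exists c.
(* [chart y n] is the family of candidate centres at level [n] together with
   their common radius; it depends on [y m] for [m < n] only. *)
pose fix chart (y : nat -> Q) n : (Q -> V) * R :=
  if n is n'.+1 then
    C (fun=> (chart y n').1 (y n'), (chart y n').2 / 2)
  else C (p, r).
pose center y n := (chart y n).1 (y n).
pose rho y n := (chart y n).2.
have rho_gt0 y n : 0 < rho y n.
  elim: n => [|n IH]; first by have [] := CP (p, r) r0.
  by have [|] := CP (fun=> center y n, rho y n / 2); rewrite //= divr_gt0.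
have chartS y n : [/\ rho y n.+1 <= rho y n / 2,
    mdist (center y n) (center y n.+1) < rho y n / 2 &
    forall q q', q != q' ->
      3 * rho y n.+1 <= mdist ((chart y n.+1).1 q) ((chart y n.+1).1 q')].
  have [|? ? cc ?] := CP (fun=> center y n, rho y n / 2).
    by rewrite /= divr_gt0.
  by split=> //; exact: cc.
have chart_sep y n q q' : q != q' ->
    3 * rho y n <= mdist ((chart y n).1 q) ((chart y n).1 q').
  case: n => [|n] qq'; last by have [_ _] := chartS y n; apply.
  by have [_ _ _] := CP (p, r) r0; apply.
have rho_le y n : rho y n <= r / 2 ^+ n.
  elim: n => [|n IH]; first by rewrite expr0 divr1; have [] := CP (p, r) r0.
  have [h _ _] := chartS y n; rewrite (le_trans h)// exprSr invfM mulrA.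
  by rewrite ler_pM2r ?invr_gt0.
have chart_eq y y' n : (forall m, (m < n)%N -> y m = y' m) ->
    chart y n = chart y' n.
  elim: n => // n IH yy' /=; rewrite IH ?yy'// => m mn; apply: yy'.
  exact: ltnW.
(* Radii are at least halved at each level and a step is shorter than half the
   current radius, so displacements telescope against the radii. *)
have center_dist y n k : mdist (center y n) (center y (n + k)%N) <=
    rho y n - rho y (n + k)%N.
  elim: k => [|k IH]; first by rewrite addn0 mdistxx subrr.
  have [h1 h2 _] := chartS y (n + k)%N; rewrite addnS.
  have := metric_triangle (center y n) (center y (n + k)%N)
    (center y (n + k).+1).
  lra.
have center_cvg y : exists l : V, center y @ \oo --> l.
  apply: V_complete; apply/cauchy_ballP => e e0.
  have [N HN] := half_pow_small r (divr_gt0 e0 (ltr0n _ 2)).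
  exists (center y @` [set n | (N <= n)%N], center y @` [set n | (N <= n)%N]).
    by split; exists N => // n /= Nn; exists n.
  move=> [_ _] [/= [n Nn <-] [m Nm <-]]; rewrite ballEmdist /=.
  have := center_dist y N (n - N)%N; have := center_dist y N (m - N)%N.
  rewrite !subnKC// => hm hn.
  have := metric_triangle (center y n) (center y N) (center y m).
  have := rho_gt0 y n; have := rho_gt0 y m; have := rho_le y N.
  rewrite (metric_sym (center y n) (center y N)); lra.
have [phi phiP] := choice center_cvg.
have phi_dist y n : mdist (center y n) (phi y) <= rho y n.
  apply/ler_addgt0Pr => e e0.
  have /metricType_numDomainType.cvgrPdist_lt/(_ _ e0)[N _ HN] := phiP y.
  have := HN (n + N)%N (leq_addl _ _); have := center_dist y n N.
  have := rho_gt0 y (n + N)%N.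
  have := metric_triangle (center y n) (center y (n + N)%N) (phi y).
  rewrite (metric_sym (phi y) (center y (n + N)%N)); lra.
exists phi; split.
- move=> y; have := phi_dist y 0%N; have := rho_le y 0%N.
  have [_ _ /(_ (y 0%N)) + _] := CP (p, r) r0.
  have := metric_triangle (p (y 0%N)) (center y 0%N) (phi y).
  rewrite expr0 divr1 /= /center /=; lra.
- move=> e e0; have [N HN] := half_pow_small r (divr_gt0 e0 (ltr0n _ 2)).
  exists N.+1 => y y' yy'.
  have cyy' : center y N = center y' N.
    rewrite /center yy'// (chart_eq y y')// => m mN; apply: yy'.
    exact: ltnW.
  have := metric_triangle (phi y) (center y N) (phi y').
  have := phi_dist y N; have := phi_dist y' N.
  have := rho_le y N; have := rho_le y' N.
  rewrite (metric_sym (phi y) (center y N)) cyy'; lra.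
- move=> y N; exists (rho y N) => // y' phiyy'.
  have rho_mono n : (n <= N)%N -> rho y N <= rho y n.
    move=> nN; have := center_dist y n (N - n)%N; rewrite subnKC//.
    by have := mdist_ge0 (center y n) (center y N); lra.
  (* At the first disagreement the charts of [y] and [y'] still coincide. *)
  elim/ltn_ind => n IH nN; apply: contrapT => /eqP ynn'.
  have yy' m : (m < n)%N -> y m = y' m.
    by move=> mn; apply: IH => //; exact: ltn_trans nN.
  have := chart_sep y n _ _ ynn'; rewrite -/(center y n) (chart_eq y y')//.
  rewrite -/(center y' n); have := phi_dist y n; have := phi_dist y' n.
  have := rho_mono n (ltnW nN).
  have -> : rho y' n = rho y n by rewrite /rho (chart_eq y y').
  have := metric_triangle (center y n) (phi y) (center y' n).
  have := metric_triangle (phi y) (phi y') (center y' n).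
  rewrite (metric_sym (phi y') (center y' n)); lra.
Qed.

(** * Finitely determined sets and maps on shift spaces *)

Section finite_determination.
Context (Q : finType).
Implicit Types (x y : full_shift Q) (s : seq int).

Lemma nbhs_agree x s : nbhs x [set y | forall k, k \in s -> x k = y k].
Proof.
elim: s => [|k s IH]; first by apply: filterS filterT => y _.
have kx : nbhs x [set y : full_shift Q | x k = y k].
  have : nbhs x (@proj int (fun=> discrete_topology Q) k @^-1` [set x k]).
    by apply: proj_continuous; exact: discrete_set1.
  by apply: filterS => y /= <-.
near=> y => j; rewrite in_cons => /orP[/eqP ->|js].
  by near: y.
by move: j js; near: y.
Unshelve. all: by end_near. Qed.

Lemma finitely_determined_open (A : set (full_shift Q)) s :
  (forall x y, (forall k, k \in s -> x k = y k) -> A x -> A y) -> open A.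
Proof.
move=> As; rewrite openE => x Ax; rewrite /interior.
apply: filterS (nbhs_agree x s) => y xy; exact: As Ax.
Qed.

Lemma continuous_to_full_shift (T : topologicalType) (f : T -> full_shift Q) :
  (forall t k, \forall t' \near t, f t k = f t' k) -> continuous f.
Proof.
move=> fk t; apply/cvg_sup => k A [B [[C oC <-] /= Cft] BA].
by apply: filterS (fk t k) => t' ftt'; apply: BA; rewrite /= -ftt'.
Qed.

Lemma full_shift_compact : compact [set: full_shift Q].
Proof.
have -> : [set: full_shift Q] =
    [set x | forall k, [set: discrete_topology Q] (x k)].
  by apply/seteqP; split.
apply: (@tychonoff int (fun=> discrete_topology Q) (fun=> setT)) => k.
by apply: finite_compact; exact: finite_finset.
Qed.

Lemma sft_closed (F : seq (seq Q)) : closed (sft F).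
Proof.
rewrite -openC openE => x /existsNP[w /not_implyP[wF /contrapT[i xw]]].
rewrite /interior.
apply: filterS (nbhs_agree x [seq i + k%:Z | k <- iota 0 (size w)]) => y xy.
move=> /(_ w wF); apply; exists i; rewrite -[RHS]xw.
by apply/eq_in_map => k kw; apply/esym/xy/map_f.
Qed.

Lemma sft_compact (F : seq (seq Q)) : compact (sft F).
Proof.
by apply: subclosed_compact full_shift_compact _ => //; exact: sft_closed.
Qed.

Definition unshift_map (x : full_shift Q) : full_shift Q := fun i => x (i - 1).

Lemma shift_mapK : cancel (@shift_map Q) unshift_map.
Proof.
by move=> x; apply/funext => i; rewrite /unshift_map /shift_map subrK.
Qed.

Lemma unshift_mapK : cancel unshift_map (@shift_map Q).
Proof.
by move=> x; apply/funext => i; rewrite /unshift_map /shift_map addrK.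
Qed.

Lemma sft_unshift_subproof (F : seq (seq Q)) (x : sft F) :
  unshift_map (\val x) \in sft F.
Proof.
case: x => x /= /set_mem Fx; apply/mem_set => w wF [i xw].
apply: (Fx w wF); exists (i - 1); rewrite -[RHS]xw.
by apply: eq_map => k /=; rewrite /unshift_map addrAC.
Qed.

Definition sft_unshift (F : seq (seq Q)) (x : sft F) : sft F :=
  exist _ (unshift_map (\val x)) (sft_unshift_subproof x).

Lemma shift_map_continuous : continuous (@shift_map Q).
Proof.
apply: continuous_to_full_shift => x k.
apply: filterS (nbhs_agree x [:: k + 1]) => y; apply.
by rewrite inE.
Qed.

Lemma unshift_map_continuous : continuous unshift_map.
Proof.
apply: continuous_to_full_shift => x k.
apply: filterS (nbhs_agree x [:: k - 1]) => y; apply.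
by rewrite inE.
Qed.

Lemma sft_shift_homeomorphism (F : seq (seq Q)) :
  homeomorphism (@sft_shift Q F).
Proof.
exists (@sft_unshift F); split.
- apply: continuous_comp_initial => x.
  apply: (@continuous_comp _ _ _ (\val : sft F -> full_shift Q) (@shift_map Q)).
    exact: initial_continuous.
  exact: shift_map_continuous.
- apply: continuous_comp_initial => x.
  apply: (@continuous_comp _ _ _ (\val : sft F -> full_shift Q) unshift_map).
    exact: initial_continuous.
  exact: unshift_map_continuous.
- by move=> x; apply: val_inj; exact: shift_mapK.
- by move=> x; apply: val_inj; exact: unshift_mapK.
Qed.

End finite_determination.

(** * Metric codings of a full shift *)

Lemma homeomorphism_comp (X Y Z : topologicalType) (f : X -> Y) (g : Y -> Z) :
  homeomorphism f -> homeomorphism g -> homeomorphism (g \o f).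
Proof.
move=> [f' [cf cf' fK f'K]] [g' [cg cg' gK g'K]]; exists (f' \o g'); split.
- by move=> x; apply: continuous_comp; [exact: cf | exact: cg].
- by move=> x; apply: continuous_comp; [exact: cg' | exact: cf'].
- exact: can_comp.
- exact: can_comp.
Qed.

Section coding.
Context {R : realType} {V : metricType R} (Q : finType).

(** A topological embedding of the full shift, in terms of finite windows:
  the first clause is (uniform) continuity, the second is injectivity together
  with continuity of the inverse on the image. *)
Definition metric_coding (phi : full_shift Q -> V) : Prop :=
  (forall e, 0 < e -> exists s : seq int, forall x y,
    (forall k, k \in s -> x k = y k) -> mdist (phi x) (phi y) < e) /\
  (forall x k, exists2 e, 0 < e & forall y,
    mdist (phi x) (phi y) < e -> x k = y k).

Definition int_of_index (n : nat) : int :=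
  if odd n then Negz n./2 else Posz n./2.

Lemma int_of_index_surj (k : int) : exists n, int_of_index n = k.
Proof.
case: k => m; [exists m.*2 | exists m.*2.+1]; rewrite /int_of_index /=.
  by rewrite odd_double doubleK.
by rewrite odd_double /= uphalf_double.
Qed.

(** The enumeration of [int] starts at 0, so the first choice made in the Cantor
  scheme is the symbol [x 0]. *)
Lemma metric_coding_exists (V_complete : complete_space V)
    (V_perfect : perfect [set: V]) (p : Q -> V) (r : R) : 0 < r ->
  exists2 phi : full_shift Q -> V, metric_coding phi &
    forall x, mdist (p (x 0)) (phi x) < r.
Proof.
move=> r0.
have r20 : 0 < r / 2 by rewrite divr_gt0.
have [phi [phi0 phic phii]] :=
  cantor_scheme_embedding V_complete V_perfect p r20.
exists (fun x => phi (fun n => x (int_of_index n))).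
  split=> [e e0|x k].
    have [N HN] := phic e e0.
    exists [seq int_of_index n | n <- iota 0 N] => x y xy; apply: HN => n nN.
    by apply: xy; rewrite map_f// mem_iota.
  have [n <-] := int_of_index_surj k.
  have [e e0 He] := phii (fun n => x (int_of_index n)) n.+1.
  by exists e => // y /He/(_ n (ltnSn _)).
move=> x; have := phi0 (fun n => x (int_of_index n)).
by rewrite mulrC divfK ?pnatr_eq0.
Qed.

Context (phi : full_shift Q -> V) (phi_coding : metric_coding phi).

Lemma metric_coding_continuous : continuous phi.
Proof.
move=> x.
apply/(@metricType_numDomainType.cvgrPdist_lt _ V _ (nbhs x)) => e e0.
have [s Hs] := phi_coding.1 e e0.
by apply: filterS (nbhs_agree x s) => y; exact: Hs.
Qed.

Lemma metric_coding_inj : injective phi.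
Proof.
move=> x y xy; apply/funext => k; have [e e0] := phi_coding.2 x k; apply.
by rewrite xy mdistxx.
Qed.

Lemma metric_coding_closed (K : set (full_shift Q)) :
  compact K -> closed (phi @` K).
Proof.
move=> cK; apply: compact_closed; first exact: metric_hausdorff.
apply: continuous_compact => //; apply: continuous_subspaceT.
exact: metric_coding_continuous.
Qed.

(** Total disconnectedness holds because fixing one coordinate splits the
  compact set [X] into two compact pieces, whose disjoint images are closed. *)
Lemma metric_coding_cantor (X : set (full_shift Q)) :
  X !=set0 -> compact X ->
  (forall x (s : seq int), X x ->
    exists2 y, X y & (forall k, k \in s -> x k = y k) /\ x <> y) ->
  is_cantor_space (phi @` X).
Proof.
move=> [x0 Xx0] cX Xp; split.
- by exists (phi x0), x0.
- apply: continuous_compact => //; apply: continuous_subspaceT.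
  exact: metric_coding_continuous.
- apply/seteqP; split => // _ [/set_mem[x Xx <-]].
  move=> [U /nbhs_ballP[e /= e0 eU] UX].
  have [s Hs] := phi_coding.1 e e0.
  have [y Xy [xy]] := Xp x s Xx; apply; apply: metric_coding_inj.
  have : [set phi x] (phi y); last by move=> /= ->.
  rewrite -UX; split; last by exists y.
  by apply: eU; rewrite ballEmdist; exact: Hs.
- move=> _ [x Xx <-]; apply/seteqP; split; last first.
    by move=> _ ->; apply: connected_component_refl; exists x.
  move=> b [C [Cx CX cC] Cb]; have [y Xy yb] := CX _ Cb.
  rewrite -yb /=; congr phi; apply: contrapT => /eqP yx.
  have [k xyk] : exists k, x k != y k.
    apply: contrapT => nk; move/eqP: yx; apply; apply/funext => k.
    by apply: contrapT => /eqP xyk; apply: nk; exists k; rewrite eq_sym.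
  pose D := [set z : full_shift Q | x k = z k].
  have oD : open D.
    apply: (@finitely_determined_open _ _ [:: k]) => z t zt.
    by rewrite /D /= => ->; apply: zt; rewrite inE.
  have oD' : open (~` D).
    apply: (@finitely_determined_open _ _ [:: k]) => z t zt nDz Dt.
    by apply: nDz; rewrite /D /= zt ?inE.
  have cl (E : set (full_shift Q)) : open (~` E) -> closed (phi @` (X `&` E)).
    rewrite openC => cE; apply: metric_coding_closed.
    exact: compact_closedI.
  have : C `&` phi @` (X `&` D) = C.
    apply: cC.
    + by exists (phi x); split => //; exists x.
    + exists (~` (phi @` (X `&` ~` D))).
        by rewrite openC; apply: cl; rewrite setCK.
      apply/seteqP; split => c [Cc].
        move=> [z [Xz Dz] zc]; split => // -[t [Xt +] tc]; apply.
        by rewrite -zc in tc; rewrite (metric_coding_inj tc).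
      move=> nc; split => //; have [z Xz zc] := CX _ Cc.
      exists z => //; split => //; apply: contrapT => nDz.
      by apply: nc; exists z.
    + by exists (phi @` (X `&` D)) => //; exact: cl.
  move=> /seteqP[_ /(_ _ Cb)[_ [z [_ Dz] zb]]].
  rewrite -yb in zb; move: Dz; rewrite (metric_coding_inj zb) /D /=.
  by move/eqP; exact/negP.
Qed.

(** The set [A] is tied to [phi] by an equation so that the self-map lives on
  the type [A] itself: the domain of a relation coded by [phi] is the image
  [phi @` sft F] only up to propositional equality. *)
Lemma metric_coding_conjugacy (F : seq (seq Q)) (A : set V)
    (f : set (V * V)) :
  A = phi @` sft F ->
  f = [set (phi x, phi (shift_map x)) | x in sft F] ->
  exists h : A -> A, [/\ is_graph_of f h, homeomorphism h &
    topologically_conjugate h (@sft_shift Q F)].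
Proof.
move=> -> ->; set A' := phi @` sft F.
have Phi_sub (x : sft F) : phi (\val x) \in A'.
  by apply/mem_set; exists (\val x) => //; exact: set_mem (valP x).
pose Phi (x : sft F) : A' := exist _ (phi (\val x)) (Phi_sub x).
have /choice[Psi PsiP] : forall a : A', exists x : sft F, phi (\val x) = \val a.
  move=> [a /= aA]; have [x Fx xa] := set_mem aA.
  by exists (exist _ x (mem_set Fx)).
have PhiK : cancel Phi Psi.
  by move=> x; apply/val_inj/metric_coding_inj; rewrite PsiP.
have PsiK : cancel Psi Phi by move=> a; apply: val_inj; rewrite /= PsiP.
have Phic : continuous Phi.
  apply: continuous_comp_initial => x.
  apply: (@continuous_comp _ _ _ (\val : sft F -> full_shift Q) phi).
    exact: initial_continuous.
  exact: metric_coding_continuous.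
have Psic : continuous Psi.
  apply: continuous_comp_initial; apply: continuous_to_full_shift => a k.
  have [e e0 He] := phi_coding.2 (\val (Psi a)) k.
  have : \forall b \near a, mdist (\val a) (\val b : V) < e.
    have /metricType_numDomainType.cvgrPdist_lt :=
      @initial_continuous A' V \val a.
    exact.
  by apply: filterS => b ab; apply: He; rewrite !PsiP.
have hPhi : homeomorphism Phi by exists Psi.
have hPsi : homeomorphism Psi by exists Phi.
exists (Phi \o (@sft_shift Q F) \o Psi); split.
- apply/seteqP; split => [_ [x Fx <-]|_ [a _ <-]].
    exists (Phi (exist _ x (mem_set Fx))) => //=.
    by rewrite PhiK.
  exists (\val (Psi a)); first exact: set_mem (valP _).
  by rewrite /= PsiP.
- apply: homeomorphism_comp hPsi _.
  apply: homeomorphism_comp hPhi; exact: sft_shift_homeomorphism.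
- exists Psi; split => //; apply/funext => a /=; by rewrite PhiK.
Qed.

End coding.

(** * Finite approximation of a relation *)

(** The covering form of compactness is applied to the filter of finite
  sequences ordered by inclusion. *)
Lemma compact_finite_net {R : realType} {V : metricType R} (A : set V) (d : R) :
  compact A -> 0 < d ->
  exists s : seq V, forall a, A a -> exists2 z, z \in s & mdist a z < d.
Proof.
move=> /compact_near_coveringP cA d0.
pose F : set_system (seq V) :=
  filter_from [set: seq V] (fun s => [set t : seq V | {subset s <= t}]).
have FF : ProperFilter F.
  apply: filter_from_proper; last by move=> s _; exists s => z.
  apply: filter_from_filter; first by exists [::].
  move=> s t _ _; exists (s ++ t) => // u /= stu.
  by split=> z zs; apply: stu; rewrite mem_cat zs ?orbT.
have : \forall s \near F, A `<=` (fun a => exists2 z, z \in s & mdist a z < d).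
  apply: cA => a Aa.
  exists (ball a d, [set s : seq V | a \in s]).
    split; first exact: nbhsx_ballx.
    by exists [:: a] => // s /= as'; apply: as'; rewrite inE.
  move=> [b s] /= [+ as']; rewrite ballEmdist /= => ab.
  by exists a => //; rewrite metric_sym.
by move=> [s _ sA]; exists s; exact: sA.
Qed.

Lemma hausdorff_dist_le {R : realType} {N : metricType R} (A B : compacts N)
    (r : R) :
  (forall a, (A : set N) a -> exists2 b, (B : set N) b & mdist a b <= r) ->
  (forall b, (B : set N) b -> exists2 a, (A : set N) a & mdist a b <= r) ->
  hausdorff_dist A B <= r.
Proof.
move=> AB BA; rewrite /hausdorff_dist ge_max; apply/andP; split.
  apply: excess_le => a /AB[b Bb]; apply: le_trans.
  exact: point_set_dist_le.
apply: excess_le => b /BA[a Aa]; rewrite metric_sym; apply: le_trans.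
exact: point_set_dist_le.
Qed.

(** Equality of the projections says that every point has both a successor and
  a predecessor; iterating choices of these continues [(a, b)] both ways. *)
Lemma biinfinite_orbit {T : Type} (f : set (T * T)) (a b : T) :
  fst @` f = snd @` f -> f (a, b) ->
  exists u : int -> T, [/\ u 0 = a, u 1 = b & forall k, f (u k, u (k + 1))].
Proof.
move=> f12 fab; set D := fst @` f.
have /choice[S SP] : forall x, exists y, D x -> f (x, y).
  move=> x; have [[[x' y] fxy /= <-]|nDx] := pselect (D x); first by exists y.
  by exists x.
have /choice[P PP] : forall y, exists x, D y -> f (x, y).
  rewrite /D f12 => y.
  have [[[x y'] fxy /= <-]|nDy] := pselect ((snd @` f) y); first by exists x.
  by exists y.
have D1 x y : f (x, y) -> D x by exists (x, y).
have D2 x y : f (x, y) -> D y by rewrite /D f12; exists (x, y).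
have DSn n : D (iter n S b).
  by elim: n => [|n /SP/D2 //]; exact: D2 fab.
have DPn n : D (iter n P a).
  by elim: n => [|n /PP/D1 //]; exact: D1 fab.
exists (fun k => match k with
  | Posz n => if n is m.+1 then iter m S b else a
  | Negz n => iter n.+1 P a
  end); split=> // -[[|n]|[|n]] /=.
- exact: fab.
- by rewrite addn1; apply: SP; exact: DSn.
- exact: (PP a (DPn 0%N)).
- by rewrite subn1; exact: (PP _ (DPn n.+1)).
Qed.

(** * The shift of walks on a digraph with a free bit at each step *)

Section labelled_edge_shift.
Context {I : finType} (G : rel I).
Local Notation Q := (I * bool)%type.

Definition forbidden_edges : seq (seq Q) :=
  [seq [:: qq.1; qq.2] | qq in [pred qq : Q * Q | ~~ G qq.1.1 qq.2.1]].

Lemma sft_forbidden_edges (x : full_shift Q) :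
  sft forbidden_edges x <-> forall k, G (x k).1 (x (k + 1)).1.
Proof.
split=> [Fx k|Gx w /mapP[[q q']]]; last first.
  rewrite mem_enum inE /= => /negP nG -> [k /= [xq xq']]; apply: nG.
  by rewrite -xq -xq' addr0; exact: Gx.
apply: contrapT => /negP nG; apply: (Fx [:: x k; x (k + 1)]).
  by apply/mapP; exists (x k, x (k + 1)); rewrite ?mem_enum ?inE.
by exists k; rewrite /= addr0.
Qed.

Lemma sft_forbidden_edges_perfect (x : full_shift Q) (s : seq int) :
  sft forbidden_edges x -> exists2 y, sft forbidden_edges y &
    (forall k, k \in s -> x k = y k) /\ x <> y.
Proof.
move=> /sft_forbidden_edges Gx.
have [j js] : exists j : int, j \notin s.
  exists (Posz (\max_(k <- s) `|k|%N).+1); apply/negP => js.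
  have := @leq_bigmax_seq _ s xpredT (fun k : int => `|k|%N) _ js isT.
  by rewrite /= ltnn.
exists (fun k => ((x k).1, if k == j then ~~ (x k).2 else (x k).2)).
  by apply/sft_forbidden_edges => k; exact: Gx.
split=> [k ks|xy].
  have [kj|_] := eqVneq k j; last by case: (x k).
  by move: js; rewrite -kj ks.
have := congr1 (fun z : full_shift Q => (z j).2) xy.
by rewrite /= eqxx; case: (x j).2.
Qed.

End labelled_edge_shift.

(** * Density *)

Theorem proposition2p16 (R : realType) (V : metricType R)
    (V_complete : complete_space V) (V_perfect : perfect [set: V]) :
  dense [set f : DS V | is_cantor_space (M f) /\ sft_homeomorphism f].
Proof.
apply/DS_denseP => f e e0.
pose fS : set (V * V) := relation_of f.
have fDS : fst @` fS = snd @` fS by apply: set_mem; exact: valP f.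
pose d := e / 3; have d0 : 0 < d by rewrite divr_gt0.
(* With [d = e / 3], a point of [M f] is [d]-close to its net point, and a coded
   point is [d]-close to the net point named by its symbol at 0; corresponding
   pairs are thus within [d + d < e] of each other. *)
have cMf : compact (M f).
  apply: continuous_compact; last exact: compacts_compact.
  by apply: continuous_subspaceT => x; exact: cvg_fst.
have [s sP] := compact_finite_net cMf d0.
have [[a0 b0] fab0] := compacts_neq0 (\val f).
pose p (q : 'I_(size s).+1 * bool) : V := nth a0 s q.1.
have /choice[r rP] : forall a, exists i : 'I_(size s).+1,
    M f a -> mdist a (nth a0 s i) < d.
  move=> a; have [Ma|nMa] := pselect (M f a); last by exists ord0.
  have [z zs az] := sP a Ma.
  have iz : (index z s < (size s).+1)%N by rewrite ltnS index_size.
  by exists (Ordinal iz); rewrite /= nth_index.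
pose G : rel 'I_(size s).+1 := fun i j =>
  `[< exists ab, [/\ fS ab, r ab.1 = i & r ab.2 = j] >].
pose F := forbidden_edges G.
have [phi phi_coding phi_p] := metric_coding_exists V_complete V_perfect p d0.
have close (a : V) (x : full_shift ('I_(size s).+1 * bool)%type) :
    M f a -> r a = (x 0).1 -> mdist a (phi x) <= d + d.
  move=> Ma rx; have := phi_p x; have := rP a Ma.
  have := metric_triangle a (p (x 0)) (phi x); rewrite /p rx; lra.
have M1 (ab : V * V) : fS ab -> M f ab.1 by exists ab.
have M2 (ab : V * V) : fS ab -> M f ab.2.
  by move=> fab; rewrite /M fDS; exists ab.
have close2 (ab : V * V) x : fS ab -> r ab.1 = (x 0).1 -> r ab.2 = (x 1).1 ->
    mdist ab (phi x, phi (shift_map x)) <= d + d.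
  move=> fab ra rb; rewrite [mdist _ _]/(max_dist _ _) /max_dist /= ge_max.
  by rewrite !close//; [exact: M2 | exact: M1].
have realized ab : fS ab ->
    exists2 x, sft F x & r ab.1 = (x 0).1 /\ r ab.2 = (x 1).1.
  case: ab => a b fab; have [u [u0 u1 uf]] := biinfinite_orbit fDS fab.
  exists (fun k => (r (u k), false)); last by rewrite u0 u1.
  apply/sft_forbidden_edges => k /=; apply/asboolP.
  by exists (u k, u (k + 1)).
pose gamma x := (phi x, phi (shift_map x)).
have cgamma : continuous gamma.
  move=> x; apply: (@cvg_pair _ _ _ (nbhs x)).
    exact: (metric_coding_continuous phi_coding).
  apply: (@continuous_comp _ _ _ (@shift_map _) phi).
    exact: shift_map_continuous.
  exact: (metric_coding_continuous phi_coding).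
have g0 : gamma @` sft F !=set0.
  by have [x Fx _] := realized _ fab0; exists (gamma x), x.
have gc : compact (gamma @` sft F).
  apply: continuous_compact; last exact: sft_compact.
  exact: continuous_subspaceT.
pose g0' := Compacts g0 gc.
have Mg1 : fst @` (gamma @` sft F) = phi @` sft F by rewrite image_comp.
have Mg2 : snd @` (gamma @` sft F) = phi @` sft F.
  rewrite image_comp; apply/seteqP; split => _ [x Fx <-].
    exists (shift_map x) => //.
    by have := set_mem (valP (sft_shift (exist _ x (mem_set Fx)))).
  have Fx' := set_mem (valP (sft_unshift (exist _ x (mem_set Fx)))).
  by exists (unshift_map x); rewrite //= unshift_mapK.
have gDS : g0' \in DS V by apply/mem_set; rewrite /DS /= Mg1 Mg2.
exists (exist _ g0' gDS : DS V).
  split.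
    rewrite /M /= [relation_of _]/(gamma @` sft F) Mg1.
    apply: (metric_coding_cantor phi_coding); last first.
    - by move=> x t; exact: sft_forbidden_edges_perfect.
    - exact: sft_compact.
    - by have [x Fx _] := realized _ fab0; exists x.
  have [//|//|h [hg hh hc]] := @metric_coding_conjugacy _ _ _ phi phi_coding F
    (M (exist _ g0' gDS : DS V)) (relation_of (exist _ g0' gDS : DS V)).
  by exists h; split => //; exists _, F.
apply: (@le_lt_trans _ _ (d + d)); last by rewrite /d; lra.
apply: hausdorff_dist_le => [ab fab|_ [x Fx <-]].
  have [x Fx [ra rb]] := realized ab fab.
  by exists (gamma x); [exists x | exact: close2].
move/sft_forbidden_edges/(_ 0): Fx => /asboolP[ab [fab ra rb]].
by exists ab => //; apply: close2; rewrite // rb add0r.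
Qed.
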